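(* Let $p>3$ be a prime. Then, modulo $p$: $$P_{\frac{p-1}2}(-31)\equiv\sum_{k=0}^{\frac{p-1}2}\binom{2k}k^2\equiv\sum_{k=0}^{\frac{p-1}2}\frac{\binom{2k}k^2}{256^k}\equiv-\Big(\frac p3\Big)\sum_{x=0}^{p-1}\Big(\frac{x^3-723x-7378}p\Big),$$ $$P_{\frac{p-1}2}(33)\equiv\sum_{k=0}^{\frac{p-1}2}(-1)^k\binom{2k}k^2\equiv(-1)^{\frac{p-1}2}\sum_{k=0}^{\frac{p-1}2}\frac{\binom{2k}k^2}{(-256)^k}\equiv(-1)^{\frac{p+1}2}\sum_{x=0}^{p-1}\Big(\frac{x^3-91x+330}p\Big),$$ $$P_{\frac{p-1}2}(-15)\equiv\sum_{k=0}^{\frac{p-1}2}\frac{\binom{2k}k^2}{2^k}\equiv\Big(\frac2p\Big)\sum_{k=0}^{\frac{p-1}2}\frac{\binom{2k}k^2}{128^k}\equiv(-1)^{\frac{p+1}2}\sum_{x=0}^{p-1}\Big(\frac{x^3-19x-30}p\Big),$$ $$P_{\frac{p-1}2}(9)\equiv\sum_{k=0}^{\frac{p-1}2}\frac{\binom{2k}k^2}{(-4)^k}\equiv(-1)^{\frac{p-1}2}\sum_{k=0}^{\frac{p-1}2}\frac{\binom{2k}k^2}{(-64)^k}\equiv(-1)^{\frac{p+1}2}\sum_{x=0}^{p-1}\Big(\frac{x^3-7x+6}p\Big),$$ $$P_{\frac{p-1}2}(5)\equiv\sum_{k=0}^{\frac{p-1}2}\frac{\binom{2k}k^2}{(-8)^k}\equiv\Big(\frac{-2}p\Big)\sum_{k=0}^{\frac{p-1}2}\frac{\binom{2k}k^2}{(-32)^k}\equiv-\Big(\frac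 p3\Big)\sum_{x=0}^{p-1}\Big(\frac{x^3-21x+20}p\Big).$$
   Context: Congruences are between rational numbers whose denominators are prime to $p$. $\big(\frac ap\big)$ is the Legendre symbol (equal to $0$ if $p\mid a$). $P_n(x)$ is the $n$-th Legendre polynomial, defined by $\frac1{\sqrt{1-2xt+t^2}}=\sum_{n\ge0}P_n(x)t^n$, equivalently $P_n(x)=\frac1{2^n}\sum_{k=0}^{[n/2]}\frac{(-1)^k(2n-2k)!}{k!(n-k)!(n-2k)!}x^{n-2k}$. *)

(* Defs.v *)
From HB Require Import structures.
From mathcomp Require Import all_boot all_order all_algebra.
Set Implicit Arguments. Unset Strict Implicit. Unset Printing Implicit Defensive.
Import Order.TTheory GRing.Theory Num.Theory.
Local Open Scope ring_scope.

Definition p_integral (p : nat) (a : rat) : bool := ~~ (p%:Z %| denq a)%Z.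

Definition rat_cong (p : nat) (a b : rat) : Prop :=
  [/\ p_integral p a, p_integral p b & (p%:Z %| numq (a - b))%Z].

Definition legendre (p : nat) (a : int) : int :=
  if (p%:Z %| a)%Z then 0
  else if [exists x : 'I_p, (p%:Z %| (x%:Z) ^+ 2 - a)%Z] then 1 else -1.

Definition legendreP (n : nat) (x : rat) : rat :=
  (2 ^+ n)^-1 * \sum_(k < n./2.+1)
     ((-1) ^+ k * ((2 * n - 2 * k)`!)%:R
        / ((k`!)%:R * ((n - k)`!)%:R * ((n - 2 * k)`!)%:R) * x ^+ (n - 2 * k)).

Definition cbsum (p : nat) (m : rat) : rat :=
  \sum_(k < (p.-1)./2.+1) ('C(2 * k, k) ^ 2)%:R / m ^+ k.

Definition charsum (p : nat) (a b : int) : rat :=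
  (\sum_(x < p) legendre p ((x%:Z) ^+ 3 + a * x%:Z + b))%:~R.

(* Main.v *)
(** Put [h = (p - 1) / 2] and [S(t) = \sum_k 'C(h, k)^2 t^k] over ['F_p].
Since [2 h = -1] in ['F_p], one has ['C(2k, k) = (-4)^k 'C(h, k)] and
['C(h + k, k) = (-1)^k 'C(h, k)], so that [\sum_k 'C(2k, k)^2 / m^k = S(16 / m)]
and [P_h(1 - 2 t) = S(t)].  The symmetry [k -> h - k] gives
[S(t) = t^h S(1 / t)], which exchanges [m] and [256 / m] up to the Legendre
symbol of [m].  Finally, by Euler's criterion the character sum of
[x (x - 1) (x - t)] is minus the coefficient of [x^(p - 1)] in the [h]-th power
of this cubic, namely [- (-1)^h S(t)]; each cubic of the statement is the
image of [x (x - 1) (x - t)] under an affine substitution. *)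
Require Import Defs.
From HB Require Import structures.
From mathcomp Require Import all_boot all_order all_algebra all_solvable all_field.
From mathcomp Require Import ring zify.
Import Order.TTheory GRing.Theory Num.Theory.
Local Open Scope ring_scope.

(** * Power sums and Euler's criterion in the prime field *)

Lemma Fp_expr_pred (p : nat) (hp : prime p) (x : 'F_p) :
  x != 0 -> x ^+ p.-1 = 1.
Proof.
move=> x0; apply: (mulfI x0); rewrite -exprS prednK ?prime_gt0 // mulr1.
by have := expf_card x; rewrite card_Fp.
Qed.

(** The [p - 1] nonzero elements are distinct roots of [X^(p-1) - 1], so [has_prim_root] applies to
    their list. *)
Lemma Fp_prim_root (p : nat) (hp : prime p) :
  exists g : 'F_p, (p.-1).-primitive_root g.
Proof.
have p1 := prime_gt1 hp.
have sz : size [seq x <- enum 'F_p | x != 0] = p.-1.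
  have := cardC1 (0 : 'F_p); rewrite card_Fp // => <-.
  by rewrite cardE size_filter enumT /enum_mem size_filter.
have /hasP[g _ gP] : has (p.-1).-primitive_root [seq x <- enum 'F_p | x != 0].
  apply: has_prim_root; rewrite ?sz //; first by lia.
    apply/allP=> x; rewrite mem_filter => /andP[x0 _].
    by apply/unity_rootP; rewrite Fp_expr_pred.
  by rewrite filter_uniq // enum_uniq.
by exists g.
Qed.

(** Scaling [x] by a generator [g] permutes the field and multiplies the sum by [g ^+ j], so the sum
    vanishes unless [g ^+ j = 1]. In that case each nonzero [x] contributes 1, and [0 < j] removes
    the term at 0. *)
Lemma Fp_sum_expr (p : nat) (hp : prime p) (j : nat) : (0 < j)%N ->
  \sum_(x : 'F_p) x ^+ j = if (p.-1 %| j)%N then -1 else 0.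
Proof.
move=> j0; have [g gP] := Fp_prim_root p hp.
have p1 := prime_gt1 hp.
case: ifPn => [/dvdnP[k jk]|ndvd].
  rewrite (bigD1 0) //= expr0n gtn_eqF //.
  rewrite add0r (eq_bigr (fun=> 1)) => [|x x0]; last first.
    by rewrite jk mulnC exprM Fp_expr_pred ?expr1n.
  rewrite sumr_const cardC1 card_Fp //.
  by apply: (addIr 1); rewrite addNr natr1 prednK ?pchar_Fp_0 //; lia.
have g0 : g != 0.
  apply/eqP => gz; have /eqP := prim_expr_order gP.
  have p10 : (0 < p.-1)%N by lia.
  by rewrite gz expr0n gtn_eqF // eq_sym oner_eq0.
have gj : g ^+ j - 1 != 0 by rewrite subr_eq0 -(prim_order_dvd gP).
apply: (mulfI gj); rewrite mulr0 mulrBl mul1r mulr_sumr.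
rewrite [X in _ - X](reindex_inj (mulfI g0)) /=.
by apply/eqP; rewrite subr_eq0; apply/eqP/eq_bigr => x _; rewrite exprMn.
Qed.

Lemma Fp_euler (p : nat) (hp : prime p) (a : 'F_p) : odd p ->
  a ^+ (p.-1)./2 =
    if a == 0 then 0 else if [exists x : 'F_p, x ^+ 2 == a] then 1 else -1.
Proof.
move=> podd; have [g gP] := Fp_prim_root p hp.
have p2 := odd_prime_gt2 podd hp.
have hh : ((p.-1)./2 * 2 = p.-1)%N by lia.
have [->|a0] := eqVneq a 0; first by rewrite expr0n; case: eqP => //; lia.
have /eqP : (a ^+ (p.-1)./2) ^+ 2 = 1 by rewrite -exprM hh Fp_expr_pred.
rewrite sqrf_eq1; case: ifPn => [/existsP[x /eqP xa] _|nsq].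
  rewrite -xa -exprM mulnC hh Fp_expr_pred //.
  by apply: contraNneq a0 => x0; rewrite -xa x0 expr0n.
case/orP=> /eqP // ah; case/negP: nsq.
(* Write [a = g ^+ i] and [h = (p.-1)./2]. Then [a ^+ h = 1] says that [2h] divides [i * h], so [i]
   is even and [a] is a square. *)
have [i ai] := prim_rootP gP (Fp_expr_pred p hp a a0).
have : (p.-1 %| i * (p.-1)./2)%N by rewrite (prim_order_dvd gP) exprM -ai ah.
rewrite -[X in (X %| _)%N]hh mulnC dvdn_pmul2r; last by lia.
case/dvdnP=> k ik; apply/existsP; exists (g ^+ k).
by rewrite ai ik -exprM.
Qed.

(** * Sums of squared binomials and the cubic power sum *)

Lemma coef_XaddC_exp (R : comNzRingType) (a : R) (n i : nat) :
  (('X + a%:P) ^+ n)`_i = a ^+ (n - i) *+ 'C(n, i).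
Proof.
rewrite addrC exprDn coef_sum.
under eq_bigr => j _ do rewrite coefMn -polyC_exp coefCM coefXn.
have [lin|ltni] := leqP i n.
  rewrite (bigD1 (Ordinal (lin : (i < n.+1)%N))) //= eqxx mulr1 big1 ?addr0 //.
  by move=> j /negbTE ji; rewrite eq_sym [_ == _]ji mulr0 mul0rn.
rewrite bin_small // mulr0n big1 // => j _.
have -> : (i == j) = false by have := ltn_ord j; lia.
by rewrite mulr0 mul0rn.
Qed.

(** For [n = (p - 1) / 2] over ['F_p] this is the Deuring polynomial of the Legendre family
    [y^2 = x (x - 1) (x - t)]. *)
Definition sqbin_sum {R : nzRingType} (n : nat) (t : R) : R :=
  \sum_(k < n.+1) 'C(n, k)%:R ^+ 2 * t ^+ k.

Lemma sqbin_sumV (F : fieldType) (n : nat) (t : F) : t != 0 ->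
  sqbin_sum n t^-1 * t ^+ n = sqbin_sum n t.
Proof.
move=> t0; rewrite /sqbin_sum [RHS](reindex_inj rev_ord_inj) mulr_suml /=.
apply: eq_bigr => k _; have kn : (k <= n)%N by rewrite -ltnS.
rewrite subSS bin_sub // -mulrA; congr (_ * _).
have -> : t ^+ n = t ^+ (n - k) * t ^+ k by rewrite -exprD subnK.
by rewrite mulrCA exprVn mulVf ?mulr1 // expf_neq0.
Qed.

(* The only exponent divisible by [p - 1] in the expanded cubic power is
   [p - 1] itself, so the sum picks out a single coefficient. *)
Lemma Fp_sum_legendre_cubic (p : nat) (hp : prime p) (t : 'F_p) : odd p ->
  let h := (p.-1)./2 in
  \sum_(x : 'F_p) (x * (x - 1) * (x - t)) ^+ h = - (-1) ^+ h * sqbin_sum h t.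
Proof.
move=> podd h; have p2 := odd_prime_gt2 podd hp.
have hh : (h * 2 = p.-1)%N by rewrite /h; lia.
have h0 : (0 < h)%N by lia.
(* [Q] omits the factor [x ^+ h], so the exponents [i + h] run from [h] to [3h], strictly between 0
   and [2(p - 1) = 4h]; only [i = h] survives. *)
pose Q : {poly 'F_p} := ('X + (-1)%:P) ^+ h * ('X + (-t)%:P) ^+ h.
have sQ : (size Q <= (2 * h).+1)%N.
  have sL (a : 'F_p) : (size (('X + a%:P) ^+ h) <= h.+1)%N.
    by apply: (leq_trans (size_poly_exp_leq _ _)); rewrite size_XaddC mul1n.
  rewrite /Q; apply: (leq_trans (size_polyMleq _ _)).
  by move: (sL (-1)) (sL (-t)); move: (size _) (size _) => a b; lia.
have QE (x : 'F_p) : (x * (x - 1) * (x - t)) ^+ h =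
    \sum_(i < (2 * h).+1) Q`_i * x ^+ (i + h).
  rewrite !exprMn mulrAC -mulrA mulrC.
  under eq_bigr => i _ do rewrite exprD mulrA.
  rewrite -mulr_suml -(horner_coef_wide _ sQ) /Q hornerM !horner_exp !hornerE.
  by rewrite -!exprMn; congr (_ ^+ _); ring.
under eq_bigr => x _ do rewrite QE.
rewrite exchange_big /=.
under eq_bigr => i _ do rewrite -mulr_sumr Fp_sum_expr ?addn_gt0 ?h0 ?orbT //.
have hi : (h < (2 * h).+1)%N by lia.
rewrite (bigD1 (Ordinal hi)) //= big1 ?addr0; last first.
  move=> i ih; case: ifP => [/dvdnP[k ik]|_]; last by rewrite mulr0.
  have i2 := ltn_ord i.
  have : (nat_of_ord i != h) by apply: contraNneq ih => ih; apply/eqP/val_inj.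
  by case: k ik => [|[|k]]; lia.
rewrite addnn -muln2 hh dvdnn mulrN1 mulNr coefM; congr (- _).
(* In the convolution, ['C(h, j)] meets ['C(h, h - j)], which gives the square; the signs
   [(-1)^(h-j)] and [(-1)^j] combine to [(-1)^h]. *)
rewrite /sqbin_sum mulr_sumr; apply: eq_bigr => j _.
have jh : (j <= h)%N by rewrite -ltnS.
rewrite !coef_XaddC_exp subKn // bin_sub // [(-t) ^+ _]exprNn.
rewrite -[X in X * _]mulr_natr -[X in _ * X]mulr_natr.
have -> : (-1) ^+ h = (-1) ^+ (h - j) * (-1) ^+ j :> 'F_p by rewrite -exprD subnK.
by ring.
Qed.

(** * Binomial coefficients modulo [p] and an expansion of Legendre polynomials *)

(** From [2h + 1 = 0] one gets [h + i = -(h - i + 1)], so [(h+1)...(h+k)] is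
    [(-1)^k h(h-1)...(h-k+1)]. The induction cancels [k + 1], which is nonzero because
    [k + 1 < p]. *)
Lemma Fp_bin_addl (p : nat) (hp : prime p) (k : nat) : odd p -> (k < p)%N ->
  let h := (p.-1)./2 in
  'C(h + k, k)%:R = (-1) ^+ k * 'C(h, k)%:R :> 'F_p.
Proof.
move=> podd kp h; have ph : p = (2 * h).+1 by rewrite /h; lia.
have p0 : (2 * h%:R + 1 : 'F_p) = 0 by rewrite -natrM natr1 -ph pchar_Fp_0.
elim: k kp => [|k IH] kp; first by rewrite !bin0 expr0 mul1r.
have k0 : (k.+1%:R : 'F_p) != 0.
  by rewrite -(dvdn_pcharf (pchar_Fp hp)) gtnNdvd.
apply: (mulfI k0); rewrite mulrCA -!natrM (mul_bin_left h).
rewrite addnS -mul_bin_diag /= natrM IH; last exact: ltnW.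
have [hk|kh] := leqP h.+1 k.
  by rewrite !bin_small ?muln0 ?mulr0 //; lia.
rewrite natrM natrB // -addnS natrD -natr1 exprS.
have -> : (h%:R + (k%:R + 1) : 'F_p) = (2 * h%:R + 1) - (h%:R - k%:R) by ring.
by rewrite p0; ring.
Qed.

(** Consecutive central binomials have ratio [2(2k+1)/(k+1)], while those of row [h] have ratio
    [(h-k)/(k+1)]; [2h + 1 = 0] turns [2(2k+1)] into [-4(h-k)]. *)
Lemma Fp_central_bin (p : nat) (hp : prime p) (k : nat) : odd p -> (k < p)%N ->
  let h := (p.-1)./2 in
  'C(2 * k, k)%:R = (-4) ^+ k * 'C(h, k)%:R :> 'F_p.
Proof.
move=> podd kp h; have ph : p = (2 * h).+1 by rewrite /h; lia.
have p0 : (2 * h%:R + 1 : 'F_p) = 0 by rewrite -natrM natr1 -ph pchar_Fp_0.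
elim: k kp => [|k IH] kp; first by rewrite !bin0 expr0 mul1r.
have k0 : (k.+1%:R : 'F_p) != 0.
  by rewrite -(dvdn_pcharf (pchar_Fp hp)) gtnNdvd.
apply: (mulfI k0); rewrite mulrCA -!natrM (mul_bin_left h).
have -> : (k.+1 * 'C(2 * k.+1, k.+1) = 2 * ((2 * k).+1 * 'C(2 * k, k)))%N.
  have e1 := mul_bin_diag (2 * k.+1) k; have e2 := mul_bin_diag (2 * k).+1 k.
  have e3 : 'C((2 * k).+1, k.+1) = 'C((2 * k).+1, k).
    by rewrite -bin_sub; [congr 'C(_, _) |]; lia.
  have e4 : (2 * k.+1).-1 = (2 * k).+1 by lia.
  by rewrite e4 in e1; rewrite e3 /= in e2; rewrite -e1 e2; lia.
rewrite mulnA natrM IH; last by lia.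
(* Beyond [h] both sides vanish; up to [h] the truncated difference [h - k] is a true one and can be
   cast by [natrB]. *)
have [hk|kh] := leqP h.+1 k.
  by rewrite bin_small ?muln0 ?mulr0 //; lia.
rewrite natrM natrM natrB // -[(2 * k).+1%:R]natr1 natrM exprS.
have -> : (2 * (2 * k%:R + 1) : 'F_p) = 2 * (2 * h%:R + 1) - 4 * (h%:R - k%:R).
  by ring.
by rewrite p0; ring.
Qed.

(* Both sides are the coefficient of [Y^n] in [((Y + x)^2 - 1)^n], expanded in
   powers of [(Y + x)^2] and of [Y + x - 1] respectively. *)
Lemma legendre_sum_shift (R : comNzRingType) (n : nat) (x : R) :
  \sum_(k < n.+1) (-1) ^+ k * 'C(n, k)%:R * 'C(2 * (n - k), n)%:R
     * x ^+ (2 * (n - k) - n) =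
  \sum_(k < n.+1) 'C(n, k)%:R * 'C(n + k, n)%:R * (x - 1) ^+ k * 2 ^+ (n - k).
Proof.
pose P : {poly R} := (('X + x%:P) ^+ 2 + (-1)%:P) ^+ n.
transitivity P`_n.
  rewrite /P exprDn coef_sum; apply: eq_bigr => k _.
  rewrite coefMn -exprM -polyC_exp coefMC coef_XaddC_exp.
  by ring.
have -> : P = ('X + (x - 1)%:P) ^+ n * (2%:P + ('X + (x - 1)%:P)) ^+ n.
  rewrite -exprMn; congr (_ ^+ _); rewrite polyCB polyCN polyC1.
  have -> : 2%:P = 2 :> {poly R} by rewrite polyCMn.
  by ring.
rewrite [(2%:P + _) ^+ n]exprDn mulr_sumr coef_sum; apply: eq_bigr => k _.
rewrite [in LHS]mulrnAr coefMn mulrCA -exprD -polyC_exp coefCM coef_XaddC_exp.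
by rewrite addKn; ring.
Qed.

(** * Reduction of rationals modulo [p] *)

(** The fraction [n / d] need not be in lowest terms, so ring operations act directly on the
    witnesses, with no gcd to control. *)
Definition reduces_to (p : nat) (r : rat) (u : 'F_p) : Prop :=
  exists n d : int,
    [/\ d%:~R != 0 :> 'F_p, r * d%:~R = n%:~R & u * d%:~R = n%:~R].

(** If [p] divided [denq q], then [numq q * d = n * denq q] would make it divide [numq q] too,
    against coprimality. Over the denominator [d * d'], the numerator of [r - s] is zero in
    ['F_p]. *)
Lemma rat_cong_reduces (p : nat) (hp : prime p) (r s : rat) (u : 'F_p) :
  reduces_to p r u -> reduces_to p s u -> rat_cong p r s.
Proof.
have dvdE := dvdz_pcharf (pchar_Fp hp).
have num0 (q : rat) (n d : int) :
    q * d%:~R = n%:~R -> numq q * d = n * denq q.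
  by move=> qd; apply: (@intr_inj rat); rewrite !rmorphM /= numqE -qd; ring.
have eqdvd (q : rat) : (p%:Z %| denq q)%Z -> (p%:Z %| numq q)%Z -> False.
  move=> pd pn; have := coprime_num_den q; rewrite /coprime => /eqP g1.
  have : (p %| gcdn `|numq q| `|denq q|)%N by rewrite dvdn_gcd; apply/andP.
  by rewrite g1 dvdn1 => /eqP p1; rewrite p1 in hp.
have integ (q : rat) (v : 'F_p) : reduces_to p q v -> p_integral p q.
  case=> n [d [d0 qd _]]; apply/negP=> pd; apply: (eqdvd q) => //.
  have := num0 q n d qd; rewrite dvdE in pd.
  move/(congr1 (fun z : int => z%:~R : 'F_p)); rewrite !rmorphM /= (eqP pd) mulr0.
  by move/eqP; rewrite mulf_eq0 (negbTE d0) orbF -dvdE.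
move=> ru su; split; [exact: integ ru | exact: integ su |].
case: ru => n [d [d0 rd ud]]; case: su => n' [d' [d0' sd ud']].
have dd0 : (d * d')%:~R != 0 :> 'F_p by rewrite rmorphM mulf_neq0.
have : (r - s) * (d * d')%:~R = (n * d' - n' * d)%:~R.
  by rewrite rmorphB !rmorphM /= -rd -sd; ring.
move/(num0 _ _ _)/(congr1 (fun z : int => z%:~R : 'F_p)).
rewrite !rmorphM rmorphB !rmorphM /= -ud -ud'.
have -> : u * d%:~R * d'%:~R - u * d'%:~R * d%:~R = 0 :> 'F_p by ring.
rewrite mul0r => /eqP; rewrite -rmorphM mulf_eq0 (negbTE dd0) orbF.
by rewrite dvdE.
Qed.

Lemma reduces_int (p : nat) (z : int) : reduces_to p z%:~R z%:~R.
Proof. by exists z, 1; split; rewrite ?mulr1 ?oner_eq0. Qed.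

Lemma reducesD (p : nat) (r s : rat) (u v : 'F_p) :
  reduces_to p r u -> reduces_to p s v -> reduces_to p (r + s) (u + v).
Proof.
move=> [n [d [d0 rd ud]]] [n' [d' [d0' sd vd]]].
exists (n * d' + n' * d), (d * d'); rewrite rmorphM mulf_neq0 //.
by rewrite !rmorphD !rmorphM /= -rd -sd -ud -vd; split; ring.
Qed.

Lemma reducesM (p : nat) (r s : rat) (u v : 'F_p) :
  reduces_to p r u -> reduces_to p s v -> reduces_to p (r * s) (u * v).
Proof.
move=> [n [d [d0 rd ud]]] [n' [d' [d0' sd vd]]].
exists (n * n'), (d * d'); rewrite rmorphM mulf_neq0 //.
by rewrite !rmorphM /= -rd -sd -ud -vd; split; ring.
Qed.

Lemma reducesV (p : nat) (r : rat) (u : 'F_p) : u != 0 ->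
  reduces_to p r u -> reduces_to p r^-1 u^-1.
Proof.
move=> u0 [n [d [d0 rd ud]]]; have n0 : n%:~R != 0 :> 'F_p by rewrite -ud mulf_neq0.
have r0 : r != 0.
  apply: contraNneq n0 => r0; move/eqP: rd.
  by rewrite r0 mul0r eq_sym intr_eq0 => /eqP ->.
by exists d, n; split=> //; rewrite -?rd -?ud mulKf.
Qed.

Lemma reducesX (p : nat) (r : rat) (u : 'F_p) (k : nat) :
  reduces_to p r u -> reduces_to p (r ^+ k) (u ^+ k).
Proof.
move=> ru; elim: k => [|k IH]; first exact: reduces_int 1.
by rewrite !exprS; apply: reducesM.
Qed.

Lemma reduces_sum (p n : nat) (r : 'I_n -> rat) (u : 'I_n -> 'F_p) :
  (forall k, reduces_to p (r k) (u k)) ->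
  reduces_to p (\sum_k r k) (\sum_k u k).
Proof.
move=> ru; apply: (big_ind2 (@reduces_to p)) => [|r1 u1 r2 u2|k _].
- exact: reduces_int 0.
- exact: reducesD.
- exact: ru.
Qed.

(** * Reduction of the Legendre polynomial, the binomial sums and the character sums *)

(** The factorial quotients are the integers ['C(h, k) * 'C(2 * (h - k), h)], up to sign, so only
    [2 ^+ h] is inverted. At [x = 1 - 2t] one has [x - 1 = -2t]; in [legendre_sum_shift] the powers
    of 2 collect to [2 ^+ h], and the sign of [(-t)^k] cancels that of ['C(h + k, k)]. *)
Lemma legendreP_reduces (p : nat) (hp : prime p) (t : int) : odd p ->
  let h := (p.-1)./2 in
  reduces_to p (legendreP h (1 - 2 * t%:~R)) (sqbin_sum h t%:~R).
Proof.
move=> podd h; have ph : p = (2 * h).+1 by have := prime_gt1 hp; rewrite /h; lia.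
have two0 : (2 : 'F_p) != 0.
  by rewrite -(dvdn_pcharf (pchar_Fp hp)) gtnNdvd // odd_prime_gt2.
pose x : 'F_p := 1 - 2 * t%:~R.
have rx : reduces_to p (1 - 2 * t%:~R) x.
  have -> : 1 - 2 * t%:~R = (1 - 2 * t)%:~R :> rat by rewrite rmorphB rmorphM.
  by have -> : x = (1 - 2 * t)%:~R; [rewrite rmorphB rmorphM | apply: reduces_int].
pose c (k : nat) : nat := ('C(h, k) * 'C(2 * (h - k), h))%N.
have -> : sqbin_sum h t%:~R = (2 ^+ h)^-1 *
    \sum_(k < h./2.+1) ((-1) ^+ k * (c k)%:R * x ^+ (h - 2 * k)) :> 'F_p.
  have h2 : (2 : 'F_p) ^+ h != 0 by rewrite expf_neq0.
  apply: (mulfI h2); rewrite mulVKf //.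
  (* The range extends to [k <= h] for free: if [2k > h], then [2(h - k) < h] and the second
     binomial is zero. *)
  transitivity (\sum_(k < h.+1) ((-1) ^+ k * (c k)%:R * x ^+ (2 * (h - k) - h))); last first.
    rewrite (bigID (fun k : 'I_h.+1 => (k < h./2.+1)%N)) /= [X in _ + X]big1 ?addr0.
      have hw : (h./2.+1 <= h.+1)%N by lia.
      rewrite (big_ord_widen _ (fun k => (-1) ^+ k * (c k)%:R * x ^+ (h - 2 * k)) hw).
      by apply: eq_bigr => k kh; congr (_ * _ ^+ _); lia.
    move=> k kh; rewrite /c [X in (_ * X)%N]bin_small ?muln0 ?mulr0 ?mul0r //.
    by have := ltn_ord k; lia.
  under eq_bigr => k _ do rewrite /c natrM mulrA.
  rewrite legendre_sum_shift /sqbin_sum mulr_sumr; apply: eq_bigr => k _.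
  have kh : (k <= h)%N by rewrite -ltnS.
  have -> : 'C(h + k, h) = 'C(h + k, k) by rewrite -[in RHS](bin_sub (leq_addl h k)) addnK.
  rewrite Fp_bin_addl //; last by lia.
  have -> : (2 : 'F_p) ^+ h = 2 ^+ (h - k) * 2 ^+ k by rewrite -exprD subnK.
  have -> : x - 1 = (-1) * 2 * t%:~R by rewrite /x; ring.
  have s1 : (-1) ^+ k * (-1) ^+ k = 1 :> 'F_p by rewrite -exprMn mulrNN mulr1 expr1n.
  rewrite !exprMn -/h; move: s1; move: ((-1) ^+ k) => s s1.
  transitivity (2 ^+ (h - k) * 2 ^+ k * ('C(h, k)%:R ^+ 2 * t%:~R ^+ k) * (s * s)); last by ring.
  by rewrite s1 mulr1.
apply: reducesM.
  by apply: reducesV; [rewrite expf_neq0 | apply/reducesX/(reduces_int p 2)].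
apply: reduces_sum => k; have kh := ltn_ord k.
apply: reducesM; last exact: reducesX.
have -> : (-1) ^+ k * ((2 * h - 2 * k)`!)%:R /
    ((k`!)%:R * ((h - k)`!)%:R * ((h - 2 * k)`!)%:R) = (-1) ^+ k * (c k)%:R :> rat.
  have f0 m : (m`!%:R : rat) != 0 by rewrite pnatr_eq0 -lt0n fact_gt0.
  rewrite -mulrA; congr (_ * _).
  have e1 : (h <= 2 * (h - k))%N by lia.
  have e2 : (k <= h)%N by lia.
  have e3 : (2 * (h - k) - h = h - 2 * k)%N by lia.
  rewrite -mulnBr -(bin_fact e1) -[in (h`!)%N](bin_fact e2) e3 /c !natrM.
  by field; rewrite !f0.
by apply: reducesM; [apply/reducesX/(reduces_int p (-1)) | apply: (reduces_int p (c k))].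
Qed.

Lemma cbsum_reduces (p : nat) (hp : prime p) (m : rat) (u : 'F_p) : odd p ->
  u != 0 -> reduces_to p m u ->
  reduces_to p (cbsum p m) (sqbin_sum (p.-1)./2 (16 / u)).
Proof.
move=> podd u0 mu; have p1 := prime_gt1 hp.
apply: reduces_sum => k; have kh := ltn_ord k.
have -> : 'C((p.-1)./2, k)%:R ^+ 2 * (16 / u) ^+ k =
    ('C(2 * k, k) ^ 2)%:R * (u ^+ k)^-1 :> 'F_p.
  rewrite natrX Fp_central_bin //; last by lia.
  have -> : 16 = (-4) ^+ 2 :> 'F_p by ring.
  by rewrite [(_ / u) ^+ k]exprMn exprVn exprAC; ring.
apply: reducesM; first exact: (reduces_int p ('C(2 * k, k) ^ 2)%N).
by apply: reducesV; [rewrite expf_neq0 | apply: reducesX].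
Qed.

Lemma legendre_Fp (p : nat) (hp : prime p) (a : int) : odd p ->
  (legendre p a)%:~R = a%:~R ^+ (p.-1)./2 :> 'F_p.
Proof.
move=> podd; have dvdE := dvdz_pcharf (pchar_Fp hp).
rewrite Fp_euler // /legendre dvdE; case: ifP => // _.
have -> : [exists x : 'I_p, (p%:Z %| x%:Z ^+ 2 - a)%Z] =
    [exists x : 'F_p, x ^+ 2 == a%:~R].
  apply/existsP/existsP => -[x].
    rewrite dvdE rmorphB rmorphXn subr_eq0 /= => xa.
    by exists x%:R.
  move=> xa; have xp : (x < p)%N by have := ltn_ord x; rewrite [X in (_ < X)%N]Fp_cast.
  exists (Ordinal xp); rewrite dvdE rmorphB rmorphXn subr_eq0 /=.
  suff -> : (nat_of_ord x)%:~R = x :> 'F_p by [].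
  by apply: val_inj; rewrite /= val_Fp_nat // modn_small.
by case: ifP.
Qed.

Lemma charsum_reduces (p : nat) (hp : prime p) (a b : int) : odd p ->
  reduces_to p (charsum p a b)
    (\sum_(x : 'F_p) (x ^+ 3 + a%:~R * x + b%:~R) ^+ (p.-1)./2).
Proof.
move=> podd.
have natI : injective (fun i : 'I_p => (nat_of_ord i)%:R : 'F_p).
  move=> i j /(congr1 val); rewrite /= !val_Fp_nat // !modn_small //.
  exact: val_inj.
have /(reindex _) -> /= : {on predT, bijective (fun i : 'I_p => (nat_of_ord i)%:R : 'F_p)}.
  by apply/onW_bij/inj_card_bij => //; rewrite card_Fp // card_ord.
rewrite /charsum rmorph_sum /=; apply: reduces_sum => x.
have -> : (x%:R ^+ 3 + a%:~R * x%:R + b%:~R) ^+ (p.-1)./2 =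
    (legendre p (x%:Z ^+ 3 + a * x%:Z + b))%:~R :> 'F_p.
  by rewrite legendre_Fp // !rmorphD rmorphXn rmorphM.
exact: reduces_int.
Qed.

(* [-3] is a square in ['F_p] exactly when [1] has a primitive cube root,
   namely [(s - 1) / 2] with [s ^ 2 = - 3]. *)
Lemma legendre3_Fp (p : nat) (hp : prime p) : (3 < p)%N ->
  (legendre 3 p)%:~R = (-3) ^+ (p.-1)./2 :> 'F_p.
Proof.
move=> p3; have podd : odd p by case: (even_prime hp) => // p2; rewrite p2 in p3.
have nat0 n : (0 < n < p)%N -> (n%:R : 'F_p) != 0.
  by case/andP=> n0 np; rewrite -(dvdn_pcharf (pchar_Fp hp)) gtnNdvd.
have two0 : (2 : 'F_p) != 0 by rewrite nat0 //; lia.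
have three0 : (3 : 'F_p) != 0 by rewrite nat0 //; lia.
have four0 : (4 : 'F_p) != 0 by rewrite (_ : 4 = 2 * 2) ?mulf_neq0 //; ring.
have [g gP] := Fp_prim_root p hp.
have n3p : ~~ (3 %| p)%N by rewrite dvdn_prime2 // neq_ltn p3.
rewrite Fp_euler // oppr_eq0 (negbTE three0) /legendre.
have -> : (3%:Z %| p%:Z)%Z = false by apply/negP; lia.
suff -> : [exists x : 'I_3, (3%:Z %| x%:Z ^+ 2 - p%:Z)%Z] =
    [exists x : 'F_p, x ^+ 2 == -3] by case: ifP.
(* The only nonzero square modulo 3 is 1, so the left side asks whether [p = 1] modulo 3. This
   avoids quadratic reciprocity. *)
transitivity (3 %| p.-1)%N.
  apply/existsP/idP => [[[[|[|[|x]]] //= xlt]]|p1]; try by lia.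
  by exists (Ordinal (isT : 1 < 3)%N); rewrite /=; lia.
apply/idP/existsP => [/dvdnP[k pk]|[s /eqP s3]].
  pose w := g ^+ k.
  have w3 : w ^+ 3 = 1 by rewrite -exprM -pk prim_expr_order.
  have w1 : w - 1 != 0.
    rewrite subr_eq0 -(prim_order_dvd gP); apply/negP=> /dvdn_leq; lia.
  have ww : w ^+ 2 + w + 1 = 0.
    by apply: (mulfI w1); transitivity (w ^+ 3 - 1); [ring | rewrite w3; ring].
  exists (2 * w + 1); apply/eqP.
  by transitivity (4 * (w ^+ 2 + w + 1) - 3); [ring | rewrite ww; ring].
pose w := (s - 1) / 2.
have ww : w ^+ 2 + w + 1 = 0.
  transitivity ((s ^+ 2 + 3) / 4); last by rewrite s3 addNr mul0r.
  by rewrite /w; field; rewrite four0 two0.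
have w1 : w != 1.
  by apply: contra three0 => /eqP w1; rewrite -ww w1; apply/eqP; ring.
have w3 : w ^+ 3 = 1.
  by apply/eqP; rewrite -subr_eq0 -(mulr0 (w - 1)) -ww; apply/eqP; ring.
have w0 : w != 0.
  by apply/eqP => w0; move/eqP: w3; rewrite w0 expr0n /= eq_sym oner_eq0.
have [i wi] := prim_rootP gP (Fp_expr_pred p hp w w0).
have d3 : (p.-1 %| i * 3)%N by rewrite (prim_order_dvd gP) exprM -wi w3.
have nd : ~~ (p.-1 %| i)%N by rewrite (prim_order_dvd gP) -wi.
(* If 3 were prime to [p - 1], then [p - 1] dividing [3i] would divide [i], forcing [w = 1]. *)
apply: contraR nd => n3; rewrite -(@Gauss_dvdl _ _ 3) // coprime_sym.
by rewrite prime_coprime.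
Qed.

(** * Affine substitution in the cubic and the five cases *)

Lemma Fp_sum_cubic_affine (p : nat) (hp : prime p) (t a b c d : 'F_p) : odd p ->
  let h := (p.-1)./2 in
  c != 0 ->
  (forall y, (c * y + d) ^+ 3 + a * (c * y + d) + b =
             c ^+ 3 * (y * (y - 1) * (y - t))) ->
  \sum_(x : 'F_p) (x ^+ 3 + a * x + b) ^+ h =
    - (- c ^+ 3) ^+ h * sqbin_sum h t.
Proof.
move=> podd h c0 cubic.
have inj : injective (fun y : 'F_p => c * y + d) by move=> y z /addIr /(mulfI c0).
rewrite (reindex_inj inj) /=.
under eq_bigr => y _ do rewrite cubic exprMn.
by rewrite -mulr_sumr Fp_sum_legendre_cubic // [(- c ^+ 3) ^+ h]exprNn; ring.
Qed.

(** All four quantities reduce to [sqbin_sum h t], as [m = 16/t] and [m' = 16t]. The factors [e] and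
    [f] are known only through their residues, since the five cases write these signs in different
    forms. *)
Lemma legendreP_cbsum_charsum (p : nat) (hp : prime p) (t m m' c d a b : int)
    (e f : rat) :
  odd p -> let h := (p.-1)./2 in
  t * m = 16 -> m * m' = 256 ->
  c%:~R != 0 :> 'F_p ->
  (forall y : 'F_p, (c%:~R * y + d%:~R) ^+ 3 + a%:~R * (c%:~R * y + d%:~R) + b%:~R =
     c%:~R ^+ 3 * (y * (y - 1) * (y - t%:~R))) ->
  reduces_to p e (m%:~R ^+ h) ->
  reduces_to p f (- (-1) ^+ h * c%:~R ^+ h) ->
  [/\ rat_cong p (legendreP h (1 - 2 * t%:~R)) (cbsum p m%:~R),
      rat_cong p (cbsum p m%:~R) (e * cbsum p m'%:~R) &
      rat_cong p (e * cbsum p m'%:~R) (f * charsum p a b)].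
Proof.
move=> podd h tm mm c0 cubic ee ff.
have hh : (h * 2 = p.-1)%N by have := prime_gt1 hp; rewrite /h; lia.
have sq1 (x : 'F_p) : x != 0 -> x ^+ h * x ^+ h = 1.
  by move=> x0; rewrite -exprD addnn -muln2 hh Fp_expr_pred.
have two0 : (2 : 'F_p) != 0.
  by rewrite -(dvdn_pcharf (pchar_Fp hp)) gtnNdvd // odd_prime_gt2.
have four0 : (4 : 'F_p) != 0 by rewrite (_ : 4 = 2 * 2) ?mulf_neq0 //; ring.
have n16 : (16 : 'F_p) != 0 by rewrite (_ : 16 = 4 * 4) ?mulf_neq0 //; ring.
have n256 : (256 : 'F_p) != 0 by rewrite (_ : 256 = 16 * 16) ?mulf_neq0 //; ring.
have {tm} tu : t%:~R * m%:~R = 16 :> 'F_p by rewrite -rmorphM tm.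
have {mm} uu : m%:~R * m'%:~R = 256 :> 'F_p by rewrite -rmorphM mm.
have rm : reduces_to p m%:~R m%:~R := reduces_int p m.
have rm' : reduces_to p m'%:~R m'%:~R := reduces_int p m'.
have rt := legendreP_reduces p hp t podd; rewrite -/h in rt.
move: (t%:~R : 'F_p) (m%:~R : 'F_p) (m'%:~R : 'F_p) tu uu rm rm' rt ee cubic.
move=> v u u' tu uu rm rm' rt ee cubic.
have u0 : u != 0 by apply: contraNneq n16 => u0; rewrite -tu u0 mulr0.
have v0 : v != 0 by apply: contraNneq n16 => v0; rewrite -tu v0 mul0r.
have u0' : u' != 0 by apply: contraNneq n256 => u0'; rewrite -uu u0' mulr0.
have rcm := cbsum_reduces p hp _ _ podd u0 rm.
have rcm' := cbsum_reduces p hp _ _ podd u0' rm'.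
have vE : 16 / u = v by rewrite -tu mulfK.
have vVE : 16 / u' = v^-1.
  apply: (mulIf u0'); rewrite mulfVK //; apply: (mulfI v0); rewrite mulVKf //.
  by apply: (mulfI u0); rewrite uu mulrCA mulrA tu; ring.
rewrite vE -/h in rcm; rewrite vVE -/h in rcm'.
(* The product [v * u] is the square 16, so [v] and [u] have the same quadratic character. *)
have vuh : v ^+ h = u ^+ h.
  apply: (mulIf (expf_neq0 h u0)); rewrite sq1 // -exprMn tu.
  by rewrite (_ : 16 = 4 * 4) ?exprMn ?sq1 //; ring.
have reB : reduces_to p (e * cbsum p m'%:~R) (sqbin_sum h v).
  by rewrite -(sqbin_sumV _ h _ v0) vuh mulrC; apply: reducesM.
have reC : reduces_to p (f * charsum p a b) (sqbin_sum h v).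
  have := reducesM _ _ _ _ _ ff (charsum_reduces p hp a b podd).
  rewrite (Fp_sum_cubic_affine _ _ v _ _ _ d%:~R podd c0) // -/h.
  (* The two factors [(-1) ^+ h] cancel, and [c ^+ h] times [(c ^+ 3) ^+ h] is
     [(c ^+ 4) ^+ h = 1]. *)
  suff -> : - (-1) ^+ h * c%:~R ^+ h * (- (- c%:~R ^+ 3) ^+ h * sqbin_sum h v) =
    sqbin_sum h v by [].
  rewrite [(- c%:~R ^+ 3) ^+ h]exprNn; transitivity (((-1) ^+ h * (-1) ^+ h) *
    (c%:~R ^+ h * (c%:~R ^+ 3) ^+ h) * sqbin_sum h v); first by ring.
  rewrite sq1 ?oppr_eq0 ?oner_eq0 // -exprMn -exprS.
  by rewrite (_ : c%:~R ^+ 4 = c%:~R ^+ 2 * c%:~R ^+ 2) ?exprMn ?sq1 ?mul1r ?expf_neq0 //; ring.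
by split; apply: rat_cong_reduces; eassumption.
Qed.

Theorem theorem2p12 (p : nat) (hp : prime p) (hp3 : (3 < p)%N) :
  let h := (p.-1)./2 in
  [/\ (* x = -31 *)
      [/\ rat_cong p (legendreP h (-31)) (cbsum p 1),
          rat_cong p (cbsum p 1) (cbsum p 256) &
          rat_cong p (cbsum p 256)
            (- (legendre 3 p)%:~R * charsum p (-723) (-7378))],
      (* x = 33 *)
      [/\ rat_cong p (legendreP h 33) (cbsum p (-1)),
          rat_cong p (cbsum p (-1)) ((-1) ^+ h * cbsum p (-256)) &
          rat_cong p ((-1) ^+ h * cbsum p (-256))
            ((-1) ^+ (p.+1)./2 * charsum p (-91) 330)],
      (* x = -15 *)
      [/\ rat_cong p (legendreP h (-15)) (cbsum p 2),
          rat_cong p (cbsum p 2) ((legendre p 2)%:~R * cbsum p 128) &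
          rat_cong p ((legendre p 2)%:~R * cbsum p 128)
            ((-1) ^+ (p.+1)./2 * charsum p (-19) (-30))],
      (* x = 9 *)
      [/\ rat_cong p (legendreP h 9) (cbsum p (-4)),
          rat_cong p (cbsum p (-4)) ((-1) ^+ h * cbsum p (-64)) &
          rat_cong p ((-1) ^+ h * cbsum p (-64))
            ((-1) ^+ (p.+1)./2 * charsum p (-7) 6)] &
      (* x = 5 *)
      [/\ rat_cong p (legendreP h 5) (cbsum p (-8)),
          rat_cong p (cbsum p (-8)) ((legendre p (-2))%:~R * cbsum p (-32)) &
          rat_cong p ((legendre p (-2))%:~R * cbsum p (-32))
            (- (legendre 3 p)%:~R * charsum p (-21) 20)]].
Proof.
move=> h; have podd : odd p by case: (even_prime hp) => // p2; rewrite p2 in hp3.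
have nat0 n : (0 < n < p)%N -> (n%:R : 'F_p) != 0.
  by case/andP=> n0 np; rewrite -(dvdn_pcharf (pchar_Fp hp)) gtnNdvd.
have two0 : (2 : 'F_p) != 0 by rewrite nat0 //; lia.
have three0 : (3 : 'F_p) != 0 by rewrite nat0 //; lia.
have hh : (h * 2 = p.-1)%N by rewrite /h; lia.
have sq1 (x : 'F_p) : x != 0 -> (x * x) ^+ h = 1.
  by move=> x0; rewrite exprMn -exprD addnn -muln2 hh Fp_expr_pred.
have sgn n : reduces_to p ((-1) ^+ n) ((-1) ^+ n) by apply/reducesX/(reduces_int p (-1)).
have leg a : reduces_to p (legendre p a)%:~R (a%:~R ^+ h).
  by rewrite -legendre_Fp //; apply: reduces_int.
have f1 : reduces_to p ((-1) ^+ (p.+1)./2) (- (-1) ^+ h * (1 : int)%:~R ^+ h).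
  have -> : (p.+1)./2 = h.+1 by lia.
  rewrite expr1n mulr1.
  by have -> : - (-1) ^+ h = (-1) ^+ h.+1 :> 'F_p by rewrite exprS mulN1r.
(* For [c = 3] the factor is [-(-3) ^+ h], which [legendre3_Fp] identifies. *)
have f3 : reduces_to p (- (legendre 3 p)%:~R) (- (-1) ^+ h * (3 : int)%:~R ^+ h).
  rewrite mulNr -exprMn mulN1r -(legendre3_Fp p hp hp3) -!rmorphN /=.
  exact: reduces_int.
(* Each case takes [t = (1 - x) / 2] and [m = 16 / t]; the roots of its cubic are [d], [d + c] and
   [d + c t], for instance -17, -14 and 31 in the first one. *)
split.
- have [||||||] := @legendreP_cbsum_charsum p hp 16 1 256 3 (-17) (-723) (-7378) 1
    (- (legendre 3 p)%:~R) podd => //.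
  + by move=> y; ring.
  + by rewrite expr1n; apply: (reduces_int p 1).
  + by rewrite mul1r.
- have [||||||] := @legendreP_cbsum_charsum p hp (-16) (-1) (-256) 1 5 (-91) 330 ((-1) ^+ h)
    ((-1) ^+ (p.+1)./2) podd => //.
  by move=> y; ring.
- have [||||||] := @legendreP_cbsum_charsum p hp 8 2 128 1 (-3) (-19) (-30) (legendre p 2)%:~R
    ((-1) ^+ (p.+1)./2) podd => //.
  by move=> y; ring.
- have [||||||] := @legendreP_cbsum_charsum p hp (-4) (-4) (-64) 1 1 (-7) 6 ((-1) ^+ h)
    ((-1) ^+ (p.+1)./2) podd => //.
  + by move=> y; ring.
  (* The square factor 4 is split off, leaving the character of -1; in the last case -8 leaves that
     of -2. *)
  + have -> : (-4 : int)%:~R = (-1) * (2 * 2) :> 'F_p by ring.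
    by rewrite exprMn sq1 // mulr1.
- have [||||||] := @legendreP_cbsum_charsum p hp (-2) (-8) (-32) 3 1 (-21) 20 (legendre p (-2))%:~R
    (- (legendre 3 p)%:~R) podd => //.
  + by move=> y; ring.
  + have -> : (-8 : int)%:~R = (-2 : int)%:~R * (2 * 2) :> 'F_p by ring.
    by rewrite exprMn sq1 // mulr1.
Qed.
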